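(* Let $A_{\mathrm m}\in\mathbb{R}^{n\times n}$ be Hurwitz, let $\gamma>0$ be given, and let $Q_\gamma:=\gamma^2(I+A_{\mathrm m}^\top A_{\mathrm m})$. Assume that the matrix $$\Theta(Q_\gamma,A_{\mathrm m})=\begin{bmatrix}0&I\\ A_{\mathrm m}^\top A_{\mathrm m}-Q_\gamma&A_{\mathrm m}-A_{\mathrm m}^\top\end{bmatrix}$$ has no eigenvalues on the imaginary axis. Then all $Z\in\mathcal{Z}_n(\Pi(Q_\gamma,A_{\mathrm m}))$ are Hurwitz if and only if $$\Lambda(Q_\gamma,A_{\mathrm m},0)<0 .$$
   Context: A square matrix is Hurwitz if all its eigenvalues have negative real parts. Matrix inequalities are in the Loewner order on symmetric (Hermitian) matrices. For $Q,R\in\mathbb{R}^{n\times n}$ and $c\in\mathbb{C}$: $\Lambda(Q,R,c):=Q-(R-cI)^*(R-cI)$, so that $\Lambda(Q_\gamma,A_{\mathrm m},0)=Q_\gamma-A_{\mathrm m}^\top A_{\mathrm m}$. $\Pi(Q,R):=\begin{bmatrix}Q-R^\top R&R^\top\\ R&-I\end{bmatrix}$. For symmetric $\Pi\in\mathbb{R}^{2n\times 2n}$: $\mathcal{Z}_n(\Pi):=\left\{Z\in\mathbb{R}^{n\times n}\ :\ \begin{bmatrix}I\\ Z\end{bmatrix}^\top\Pi\begin{bmatrix}I\\ Z\end{bmatrix}\ge0\right\}$. Thus $Z\in\mathcal{Z}_n(\Pi(Q_\gamma,A_{\mathrm m}))$ if and only if $(A_{\mathrm m}-Z)^\top(A_{\mathrm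 m}-Z)\le Q_\gamma$. *)

(* Defs.v *)
From HB Require Import structures.
From mathcomp Require Import all_boot all_order all_algebra.
From mathcomp Require Import sesquilinear spectral.
From mathcomp Require Import classical_sets reals.
From mathcomp.real_closed Require Import complex.

Set Implicit Arguments.
Unset Strict Implicit.
Unset Printing Implicit Defensive.

Import Order.TTheory GRing.Theory Num.Theory.

Local Open Scope ring_scope.
Local Open Scope complex_scope.
Local Open Scope sesquilinear_scope.
Local Open Scope classical_set_scope.

(** The reals are an arbitrary [R : realType], the complex numbers are [R[i]]. *)

Definition complexmx (R : realType) (m n : nat) (A : 'M[R]_(m, n)) :
    'M[R[i]]_(m, n) := map_mx (real_complex R) A.

(** Eigenvalues of a real matrix are its complex ones. *)

Definition hurwitz (R : realType) (n : nat) (A : 'M[R]_n) : Prop :=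
  forall l : R[i], eigenvalue (complexmx A) l -> complex.Re l < 0.

Definition no_imaginary_eigenvalue (R : realType) (n : nat) (A : 'M[R]_n) :
    Prop :=
  forall l : R[i], eigenvalue (complexmx A) l -> complex.Re l != 0.

(** Loewner order, non-strict on real symmetric matrices and strict on complex
    Hermitian ones. In [loewner_lt] the comparison is that of [R[i]], where
    [x < y] means that [y - x] is a positive real. *)

Definition loewner_le (R : realType) (n : nat) (A B : 'M[R]_n) : Prop :=
  [/\ A \is symmetricmx, B \is symmetricmx &
      forall x : 'cV[R]_n,
        (x^T *m A *m x) ord0 ord0 <= (x^T *m B *m x) ord0 ord0].

Definition loewner_lt (R : realType) (n : nat) (A B : 'M[R[i]]_n) : Prop :=
  [/\ A \is hermsymmx, B \is hermsymmx &
      forall x : 'cV[R[i]]_n, x != 0 ->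
        (x ^t* *m A *m x) ord0 ord0 < (x ^t* *m B *m x) ord0 ord0].

Definition Lambda (R : realType) (n : nat) (Q A : 'M[R]_n) (c : R[i]) :
    'M[R[i]]_n :=
  complexmx Q - (complexmx A - c%:M) ^t* *m (complexmx A - c%:M).

Definition Pi (R : realType) (n : nat) (Q A : 'M[R]_n) : 'M[R]_(n + n) :=
  block_mx (Q - A^T *m A) A^T
           A              (- 1%:M).

Definition Theta (R : realType) (n : nat) (Q A : 'M[R]_n) : 'M[R]_(n + n) :=
  block_mx 0              1%:M
           (A^T *m A - Q) (A - A^T).

Definition Zset (R : realType) (n : nat) (P : 'M[R]_(n + n)) :
    set 'M[R]_n :=
  [set Z : 'M[R]_n |
    loewner_le 0 ((col_mx 1%:M Z)^T *m P *m col_mx 1%:M Z)].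

Definition Qgamma (R : realType) (n : nat) (gamma : R) (A : 'M[R]_n) :
    'M[R]_n :=
  gamma ^+ 2 *: (1%:M + A^T *m A).

(* Main.v *)
Require Import Defs.
From mathcomp Require Import all_boot all_order all_algebra.
From mathcomp Require Import sesquilinear spectral.
From mathcomp Require Import boolp reals classical_sets.
From mathcomp.real_closed Require Import complex.
From mathcomp Require Import ring lra.

(** Write [A] for [Am] and [Q] for [Qgamma gamma Am], which is symmetric and
    positive definite.  A matrix [Z] belongs to the set in question iff
    [D := A - Z] satisfies [D^T D <= Q] ([Pi_form]).

    If all such [Z] are Hurwitz, none of them is singular.  A real [x <> 0] with
    [|A x|^2 <= x^T Q x] would however yield a singular one: the rank-one [D]
    that sends [y] to [(x^T Q y / x^T Q x) A x] agrees with [A] at [x], so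
    [(A - D) x = 0], and [D^T D <= Q] is the Cauchy-Schwarz inequality for the
    form [Q] ([singular_perturbation]).  So [Q - A^T A], which is
    [Lambda Q A 0], is negative definite on real vectors, hence on complex ones.

    The converse applies one continuation principle ([stable_along_path]) twice:
    along a Lipschitz path of complex matrices none of which has an eigenvalue
    on the imaginary axis, stability (all eigenvalues in the open left
    half-plane) propagates from one end to the other.

    The first path is [t |-> Lambda Q A (t c)] with [c] imaginary.  These
    matrices are Hermitian, so they are stable exactly when they are negative
    definite, and their only possible eigenvalue on the imaginary axis is [0].
    But a kernel vector of [Lambda Q A (t c)] extends to an eigenvector of
    [Theta Q A] for the imaginary number [t c] ([Theta_eigenvalue]).  So
    negative definiteness spreads from [Lambda Q A 0] to the whole imaginary
    axis.

    The second path is the segment [A - t D] from [A] to [Z].  If it met the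
    imaginary axis, say [(A - t D) x = l x], then [(A - l) x = t D x] and
    [|(A - l) x|^2 <= |D x|^2 <= x^* Q x], against [Lambda Q A l < 0].  As
    [A] is Hurwitz, so is [Z].

    The continuation principle avoids continuity of roots.  For a monic [p] of
    degree [n], [|p(l)| >= d^n] as soon as every root is at distance at least
    [d] from [l], because [p(l)] is the product of the differences.  So an
    eigenvalue [l] of one matrix at distance [d] or more from the spectrum of
    another forces a gap of size [d^n] between the two characteristic
    polynomials at [l]; along the path that gap is at most a constant times the
    elapsed time.  Hence both stability and its failure are open conditions, and
    a locally constant property on [[0, 1]] is constant. *)

Set Implicit Arguments.
Unset Strict Implicit.
Unset Printing Implicit Defensive.

Import Order.TTheory GRing.Theory Num.Theory.
Local Open Scope ring_scope.
Local Open Scope complex_scope.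
Local Open Scope sesquilinear_scope.

(** * Local constancy on the unit interval *)

(** The supremum of the times at which [P] holds satisfies [P], and cannot be
    smaller than [1] because [P] persists slightly beyond it. *)
Lemma locally_constant_unit_interval (R : realType) (P : R -> Prop) :
  (forall t, 0 <= t <= 1 -> exists2 d, 0 < d &
     forall s, 0 <= s <= 1 -> `|s - t| < d -> (P s <-> P t)) ->
  P 0 -> P 1.
Proof.
move=> Ploc P0.
pose E : set R := fun t => 0 <= t <= 1 /\ P t.
have E0 : E 0 by split => //; rewrite lexx ler01.
have Eub : ubound E 1 by move=> t [/andP[]].
have hsE : has_sup E by split; [exists 0 | exists 1].
have c1 : sup E <= 1 by apply: ge_sup => //; exists 0.
have c0 : 0 <= sup E by apply: ub_le_sup => //; exists 1.
have [|d d0 Pd] := Ploc (sup E); first by rewrite c0.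
have [e [e01 Pe] le] := sup_adherent d0 hsE.
have ec : e <= sup E by apply: ub_le_sup; [exists 1 | split].
have Pc : P (sup E).
  apply: (proj1 (Pd e e01 _) Pe).
  by rewrite ler0_norm ?subr_le0 //; lra.
have [c_lt1|c_ge1] := ltP (sup E) 1; last first.
  by have -> : 1 = sup E :> R by apply/le_anti; rewrite c1 c_ge1.
(* A time just beyond the supremum, still in the unit interval. *)
pose s := Num.min 1 (sup E + d / 2).
have ds : sup E < s by rewrite /s lt_min c_lt1 /=; lra.
have s01 : 0 <= s <= 1.
  by rewrite (ltW (le_lt_trans c0 ds)) /= /s ge_min lexx.
have : s <= sup E.
  apply: ub_le_sup; first by exists 1.
  split => //; apply: (proj2 (Pd s s01 _)) => //.
  rewrite ger0_norm ?subr_ge0 ?(ltW ds) //.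
  have : s <= sup E + d / 2 by rewrite /s ge_min lexx orbT.
  by lra.
by rewrite leNgt ds.
Qed.

(** * Functions that are Lipschitz in time *)

Lemma real_of_norm (R : realType) (z : R[i]) :
  (complex.Re `|z|)%:C = `|z| :> R[i].
Proof. by rewrite RRe_real ?normr_real. Qed.

Lemma re_norm_ge0 (R : realType) (z : R[i]) : 0 <= complex.Re `|z| :> R.
Proof. by rewrite -ler0c real_of_norm. Qed.

Lemma norm_real_complex (R : realType) (x : R) :
  `|x%:C| = (`|x|)%:C :> R[i].
Proof.
by rewrite normc_def /= expr0n /= addr0 sqrtr_sqr.
Qed.

(** Functions of a time in [[0, 1]] and of a complex parameter in [D], bounded
    and Lipschitz in time uniformly in the parameter.  Asking for the bound too
    makes the class stable under products, hence under determinants. *)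
Definition time_lipschitz (R : realType) (D : R[i] -> Prop)
    (f : R -> R[i] -> R[i]) : Prop :=
  exists2 K : R, 0 <= K & forall s t l, 0 <= s <= 1 -> 0 <= t <= 1 -> D l ->
    `|f s l| <= K%:C /\ `|f s l - f t l| <= (K * `|s - t|)%:C.

Lemma time_lipschitz_sub (R : realType) (D D' : R[i] -> Prop) f :
  (forall l, D l -> D' l) -> time_lipschitz D' f -> time_lipschitz D f.
Proof. by move=> sub [K K0 h]; exists K => // s t l s1 t1 /sub; apply: h. Qed.

Lemma time_lipschitz_ext (R : realType) (D : R[i] -> Prop) f g :
  (forall s l, f s l = g s l) -> time_lipschitz D f -> time_lipschitz D g.
Proof.
by move=> fg [K K0 h]; exists K => // s t l s1 t1 /h; rewrite -!fg; apply.
Qed.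

Lemma time_lipschitz_indep (R : realType) (D : R[i] -> Prop) (g : R[i] -> R[i])
    (K : R) :
  0 <= K -> (forall l, D l -> `|g l| <= K%:C) ->
  time_lipschitz D (fun _ l => g l).
Proof.
move=> K0 h; exists K => // s t l s1 t1 /h gl; split => //.
by rewrite subrr normr0 lecR mulr_ge0.
Qed.

Lemma time_lipschitz_const (R : realType) (D : R[i] -> Prop) (c : R[i]) :
  time_lipschitz D (fun _ _ => c).
Proof.
apply: (@time_lipschitz_indep R D (fun=> c) (complex.Re `|c|)).
  exact: re_norm_ge0.
by move=> _ _; rewrite real_of_norm.
Qed.

Lemma time_lipschitz_time (R : realType) (D : R[i] -> Prop) :
  time_lipschitz D (fun s _ => s%:C).
Proof.
exists 1 => // s t l /andP[s0 s1] _ _; split.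
  by rewrite norm_real_complex lecR ger0_norm.
by rewrite -rmorphB norm_real_complex mul1r.
Qed.

Lemma time_lipschitzD (R : realType) (D : R[i] -> Prop) f g :
  time_lipschitz D f -> time_lipschitz D g ->
  time_lipschitz D (fun s l => f s l + g s l).
Proof.
move=> [K K0 hf] [L L0 hg]; exists (K + L); first exact: addr_ge0.
move=> s t l s1 t1 Dl.
have [f1 f2] := hf s t l s1 t1 Dl; have [g1 g2] := hg s t l s1 t1 Dl.
rewrite mulrDl !rmorphD /=; split.
  exact: le_trans (ler_normD _ _) (lerD f1 g1).
rewrite opprD addrACA; exact: le_trans (ler_normD _ _) (lerD f2 g2).
Qed.

Lemma time_lipschitzM (R : realType) (D : R[i] -> Prop) f g :
  time_lipschitz D f -> time_lipschitz D g ->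
  time_lipschitz D (fun s l => f s l * g s l).
Proof.
move=> [K K0 hf] [L L0 hg]; have KL0 : 0 <= K * L by exact: mulr_ge0.
exists (2 * (K * L)); first by rewrite mulr_ge0.
move=> s t l s1 t1 Dl.
have [f1 f2] := hf s t l s1 t1 Dl; have [g1 g2] := hg s t l s1 t1 Dl.
have [g3 _] := hg t s l t1 s1 Dl; split.
  rewrite normrM; apply: (@le_trans _ _ (K * L)%:C).
    by rewrite rmorphM ler_pM.
  by rewrite lecR ler_peMl // ler1n.
have -> : f s l * g s l - f t l * g t l =
  f s l * (g s l - g t l) + (f s l - f t l) * g t l by ring.
apply: le_trans (ler_normD _ _) _; rewrite !normrM.
have -> : 2 * (K * L) * `|s - t| = K * (L * `|s - t|) + (K * `|s - t|) * L.
  by ring.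
by rewrite rmorphD !(rmorphM _ K) (rmorphM _ _ L) /= lerD // ler_pM.
Qed.

Lemma time_lipschitzN (R : realType) (D : R[i] -> Prop) f :
  time_lipschitz D f -> time_lipschitz D (fun s l => - f s l).
Proof.
move=> hf; apply: (@time_lipschitz_ext R D (fun s l => -1 * f s l)).
  by move=> s l; rewrite mulN1r.
exact/time_lipschitzM/hf/time_lipschitz_const.
Qed.

Lemma time_lipschitz_sum (R : realType) (D : R[i] -> Prop) (I : Type)
    (r : seq I) (f : I -> R -> R[i] -> R[i]) :
  (forall i, time_lipschitz D (f i)) ->
  time_lipschitz D (fun s l => \sum_(i <- r) f i s l).
Proof.
move=> hf; elim: r => [|i r IH].
  by apply: time_lipschitz_ext (time_lipschitz_const D 0) => s l;
    rewrite big_nil.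
by apply: time_lipschitz_ext (time_lipschitzD (hf i) IH) => s l;
  rewrite big_cons.
Qed.

Lemma time_lipschitz_prod (R : realType) (D : R[i] -> Prop) (I : Type)
    (r : seq I) (f : I -> R -> R[i] -> R[i]) :
  (forall i, time_lipschitz D (f i)) ->
  time_lipschitz D (fun s l => \prod_(i <- r) f i s l).
Proof.
move=> hf; elim: r => [|i r IH].
  by apply: time_lipschitz_ext (time_lipschitz_const D 1) => s l;
    rewrite big_nil.
by apply: time_lipschitz_ext (time_lipschitzM (hf i) IH) => s l;
  rewrite big_cons.
Qed.

(** * Continuation of stability along a path *)

Definition lipschitz_path (R : realType) (n : nat) (M : R -> 'M[R[i]]_n) :=
  forall i j, time_lipschitz (fun=> True) (fun s _ => M s i j).

Lemma horner_char_poly (F : comNzRingType) (n : nat) (A : 'M[F]_n) (l : F) :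
  (char_poly A).[l] = \det (l%:M - A).
Proof.
rewrite -[LHS]/(horner_eval l (char_poly A)) /char_poly -det_map_mx.
congr (\det _); apply/matrixP=> i j; rewrite !mxE.
rewrite -[LHS]/(('X *+ (i == j) - (A i j)%:P).[l]).
by rewrite !(hornerD, hornerN, hornerC, hornerMn, hornerX).
Qed.

Lemma time_lipschitz_char_poly (R : realType) (n : nat) (M : R -> 'M[R[i]]_n)
    (B : R) : lipschitz_path M ->
  time_lipschitz (fun l => `|l| <= B%:C) (fun s l => (char_poly (M s)).[l]).
Proof.
move=> hM; apply: (@time_lipschitz_ext R _
  (fun s l => \det (l%:M - M s))) => [s l|]; first by rewrite horner_char_poly.
have entry i j :
    time_lipschitz (fun l => `|l| <= B%:C) (fun s l => (l%:M - M s) i j).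
  apply: (@time_lipschitz_ext R _ (fun s l => l *+ (i == j) + - M s i j)).
    by move=> s l; rewrite !mxE.
  apply: time_lipschitzD; last first.
    by apply: time_lipschitzN; apply: time_lipschitz_sub (hM i j).
  apply: (@time_lipschitz_indep R _ (fun l => l *+ (i == j)) `|B|) => // l lB.
  case: (i == j) => /=; rewrite ?mulr1n ?mulr0n ?normr0 ?ler0c //.
  by apply: le_trans lB _; rewrite lecR ler_norm.
apply: time_lipschitz_sum => sg; apply: time_lipschitzM.
  exact: time_lipschitz_const.
by apply: time_lipschitz_prod => i; apply: entry.
Qed.

(** [p(l)] is the product of the differences between [l] and the roots. *)
Lemma monic_root_distance (R : realType) (p : {poly R[i]}) (d : R) (l : R[i]) :
  p \is monic -> 0 <= d -> (forall m, root p m -> d%:C <= `|l - m|) ->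
  (d ^+ (size p).-1)%:C <= `|p.[l]|.
Proof.
move=> /monicP lp d0 far; have [rs] := closed_field_poly_normal p.
rewrite lp scale1r => pE; move: far; rewrite {}pE => {lp}.
rewrite size_prod_XsubC /= => far.
have {}far m : m \in rs -> d%:C <= `|l - m|.
  by move=> mrs; apply: far; rewrite root_prod_XsubC.
rewrite horner_prod normr_prod; elim: rs far => [|m rs IH] far.
  by rewrite big_nil /= expr0.
rewrite big_cons /= exprS rmorphM /= hornerXsubC ler_pM ?ler0c ?exprn_ge0 //.
  by apply: far; rewrite inE eqxx.
by apply: IH => k krs; apply: far; rewrite inE krs orbT.
Qed.

(** Sum the moduli of the coordinates of [v M = l v].  Summing, rather than
    picking a coordinate of largest modulus, stays within the partial order of
    the complex numbers. *)
Lemma eigenvalue_entry_bound (R : realType) (n : nat) (M : 'M[R[i]]_n) (K : R)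
    (l : R[i]) : (forall i j, `|M i j| <= K%:C) -> eigenvalue M l ->
  `|l| <= (n%:R * K)%:C.
Proof.
move=> MK /eigenvalueP[v vM v0].
have S0 : 0 < \sum_j `|v ord0 j|.
  rewrite lt_neqAle sumr_ge0 // andbT eq_sym; apply: contra v0 => /eqP S0.
  apply/eqP/rowP => j; rewrite mxE; apply/normr0_eq0.
  by apply: (psumr_eq0P (fun k _ => normr_ge0 (v ord0 k)) S0).
rewrite -(ler_pM2r S0) mulr_sumr.
apply: (@le_trans _ _ (\sum_(j < n) \sum_(i < n) `|v ord0 i| * K%:C)).
  apply: ler_sum => j _; rewrite -normrM.
  have -> : l * v ord0 j = (v *m M) ord0 j by rewrite vM mxE.
  rewrite mxE; apply: le_trans (ler_norm_sum _ _ _) _.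
  by apply: ler_sum => i _; rewrite normrM ler_wpM2l.
rewrite sumr_const card_ord -mulr_suml rmorphM /= rmorph_nat.
by rewrite -[_ *+ n]mulr_natl -mulrA [X in n%:R * X <= _]mulrC.
Qed.

Lemma finite_margin (R : realType) (rs : seq R[i]) :
  (forall m, m \in rs -> complex.Re m < 0) ->
  exists2 d : R, 0 < d & forall m, m \in rs -> complex.Re m <= - d.
Proof.
elim: rs => [|m rs IH] h; first by exists 1.
have [|d d0 dP] := IH; first by move=> k krs; apply: h; rewrite inE krs orbT.
have m0 : complex.Re m < 0 by apply: h; rewrite inE eqxx.
exists (Num.min d (- complex.Re m)); first by rewrite lt_min d0 oppr_gt0.
move=> k; rewrite inE => /predU1P[->|/dP kd].
  by rewrite lerNr ge_min lexx orbT.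
by apply: le_trans kd _; rewrite lerN2 ge_min lexx.
Qed.

(** [hurwitz A] is [stable_mx (complexmx A)]; the complex version also covers
    the Hermitian matrices [Lambda Q A c]. *)
Definition stable_mx (R : realType) (n : nat) (M : 'M[R[i]]_n) : Prop :=
  forall l : R[i], eigenvalue M l -> complex.Re l < 0.

Lemma stable_margin (R : realType) (n : nat) (M : 'M[R[i]]_n) :
  stable_mx M ->
  exists2 d : R, 0 < d & forall m, eigenvalue M m -> complex.Re m <= - d.
Proof.
move=> hM; have [rs pE] := closed_field_poly_normal (char_poly M).
have rsE m : eigenvalue M m = (m \in rs).
  rewrite eigenvalue_root_char pE (monicP (char_poly_monic M)) scale1r.
  by rewrite root_prod_XsubC.
have [|d d0 dP] := @finite_margin R rs.
  by move=> m; rewrite -rsE; apply: hM.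
by exists d => // m; rewrite rsE; apply: dP.
Qed.

Lemma re_distance_le_norm (R : realType) (l m : R[i]) :
  (complex.Re l - complex.Re m)%:C <= `|l - m|.
Proof.
apply: le_trans (normc_ge_Re _); rewrite lecR raddfB /=.
exact: ler_norm.
Qed.

(** Quantitative substitute for the continuity of roots: [l] is a root of the
    characteristic polynomial of [N], and every root of that of [M] is at
    distance at least [d] from [l] since the real parts already are. *)
Lemma eigenvalue_jump (R : realType) (n : nat) (M N : 'M[R[i]]_n) (d : R)
    (l : R[i]) : 0 <= d -> eigenvalue N l ->
  (forall m, eigenvalue M m -> d <= complex.Re l - complex.Re m) ->
  (d ^+ n)%:C <= `|(char_poly M).[l] - (char_poly N).[l]|.
Proof.
move=> d0; rewrite eigenvalue_root_char => /rootP rl far.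
rewrite [X in _ - X]rl subr0.
have := @monic_root_distance R _ d l (char_poly_monic M) d0.
rewrite size_char_poly; apply => m; rewrite -eigenvalue_root_char => /far dm.
by apply: le_trans (re_distance_le_norm _ _); rewrite lecR.
Qed.

(** Keeps all eigenvalues met along the path in one disk, over which the
    characteristic polynomials have a common Lipschitz constant. *)
Lemma lipschitz_path_bound (R : realType) (n : nat) (M : R -> 'M[R[i]]_n) :
  lipschitz_path M ->
  exists B : R, forall s l, 0 <= s <= 1 -> eigenvalue (M s) l -> `|l| <= B%:C.
Proof.
move=> hM.
have ex_bound ij : exists k : R, 0 <= k /\
    forall s, 0 <= s <= 1 -> `|M s ij.1 ij.2| <= k%:C.
  have [k k0 kP] := hM ij.1 ij.2; exists k; split => // s s1.
  by have [] := kP s s 0 s1 s1 I.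
have [K KP] := choice ex_bound.
(* The sum of the bounds is a common bound for the finitely many entries. *)
exists (n%:R * \sum_ij K ij) => s l s1; apply: eigenvalue_entry_bound => i j.
apply: le_trans (proj2 (KP (i, j)) s s1) _; rewrite lecR (bigD1 (i, j)) //=.
by rewrite lerDl sumr_ge0 // => ij _; case: (KP ij).
Qed.

(** Near a stable matrix the spectrum has a margin [d] to the imaginary axis, so
    a nearby matrix cannot have an eigenvalue with nonnegative real part.  Near
    a matrix with an eigenvalue [l] to the right of the axis, a stable matrix
    would have its whole spectrum at distance at least [Re l] from [l]. *)
Lemma stable_along_path (R : realType) (n : nat) (M : R -> 'M[R[i]]_n) :
  lipschitz_path M ->
  (forall t, 0 <= t <= 1 -> forall l, eigenvalue (M t) l ->
     complex.Re l != 0) ->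
  stable_mx (M 0) -> stable_mx (M 1).
Proof.
move=> hM noim.
apply: (@locally_constant_unit_interval R (fun t => stable_mx (M t))).
have [B BP] := lipschitz_path_bound hM.
have [K K0 KP] := time_lipschitz_char_poly B hM.
have jump s t d l : 0 <= s <= 1 -> 0 <= t <= 1 -> 0 <= d -> `|l| <= B%:C ->
    eigenvalue (M t) l ->
    (forall m, eigenvalue (M s) m -> d <= complex.Re l - complex.Re m) ->
    d ^+ n <= K * `|s - t|.
  move=> s1 t1 d0 lB el far; rewrite -lecR.
  apply: le_trans (eigenvalue_jump d0 el far) _.
  by have [] := KP s t l s1 t1 lB.
(* [K + 1] rather than [K], as [K] may vanish. *)
have small d x : 0 < d -> x < d ^+ n / (K + 1) -> ~ d ^+ n <= K * x.
  move=> d0; rewrite ltr_pdivlMr ?ltr_wpDl // => h1 h2.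
  have dn : 0 < d ^+ n by rewrite exprn_gt0.
  have := lt_le_trans h1 h2; rewrite mulrDr mulr1 mulrC gtrDl => x0.
  have : K * x <= 0 by rewrite mulr_ge0_le0 // ltW.
  by rewrite leNgt (lt_le_trans dn h2).
move=> t t1; have [st|nst] := EM (stable_mx (M t)).
  have [d d0 dP] := stable_margin st.
  exists (d ^+ n / (K + 1)); first by rewrite divr_gt0 ?exprn_gt0 ?ltr_wpDl.
  move=> s s1 st_lt; split=> [_|_]; first exact: st.
  move=> l el; rewrite ltNge; apply/negP => l0.
  apply: (small d `|t - s| d0); first by rewrite distrC; exact: st_lt.
  apply: (jump t s d l t1 s1 (ltW d0) (BP s l s1 el) el) => m /dP; lra.
have [l el l0] : exists2 l, eigenvalue (M t) l & 0 < complex.Re l.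
  apply: contrapT => nl; apply: nst => l el.
  rewrite lt_neqAle (noim t t1 l el) /= leNgt.
  by apply/negP => l0; apply: nl; exists l.
exists (complex.Re l ^+ n / (K + 1)).
  by rewrite divr_gt0 ?exprn_gt0 ?ltr_wpDl.
move=> s s1 st_lt; split=> [ss|/nst []]; exfalso.
apply: (small _ _ l0 st_lt).
apply: (jump s t _ l s1 t1 (ltW l0) (BP t l t1 el) el) => m /ss; lra.
Qed.

(** * Hermitian matrices: stability and negative definiteness *)

Lemma hermsymmxE (C : numClosedFieldType) (n : nat) (M : 'M[C]_n) :
  (M \is hermsymmx) = (M ^t* == M).
Proof. by rewrite qualifE /= expr0 scale1r eq_sym. Qed.

Lemma symmetricmxE (R : realType) (n : nat) (S : 'M[R]_n) :
  (S \is symmetricmx) = (S^T == S).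
Proof. by rewrite qualifE /= expr0 scale1r map_mx_id // eq_sym. Qed.

Lemma trmxCM (C : numClosedFieldType) (m n p : nat) (A : 'M[C]_(m, n))
  (B : 'M[C]_(n, p)) : (A *m B) ^t* = B ^t* *m A ^t*.
Proof. by rewrite trmx_mul map_mxM. Qed.

Lemma complexmx_conj (R : realType) (m n : nat) (A : 'M[R]_(m, n)) :
  (complexmx A) ^t* = complexmx A^T.
Proof. by apply/matrixP=> i j; rewrite !mxE; exact: conjc_real. Qed.

Lemma complexmxM (R : realType) (m n p : nat) (A : 'M[R]_(m, n))
  (B : 'M[R]_(n, p)) : complexmx (A *m B) = complexmx A *m complexmx B.
Proof. exact: map_mxM. Qed.

Lemma complexmxB (R : realType) (m n : nat) (A B : 'M[R]_(m, n)) :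
  complexmx (A - B) = complexmx A - complexmx B.
Proof. exact: map_mxB. Qed.

Lemma norm_sq_gt0 (C : numClosedFieldType) (n : nat) (v : 'rV[C]_n) :
  v != 0 -> 0 < (v *m v ^t*) ord0 ord0.
Proof. by rewrite -dotmxE; apply: dotmx_is_dotmx. Qed.

Lemma norm_sq_ge0 (C : numClosedFieldType) (n : nat) (v : 'cV[C]_n) :
  0 <= (v ^t* *m v) ord0 ord0.
Proof.
by rewrite mxE sumr_ge0 // => i _; rewrite !mxE mulrC mul_conjC_ge0.
Qed.

(** Eigenvalues are defined by row vectors, but a square matrix and its
    transpose have the same characteristic polynomial. *)
Lemma column_eigenvector (F : fieldType) (n : nat) (M : 'M[F]_n) (l : F) :
  eigenvalue M l -> exists2 x : 'cV[F]_n, x != 0 & M *m x = l *: x.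
Proof.
rewrite eigenvalue_root_char => /rootP; rewrite horner_char_poly => /eqP.
rewrite -det_tr => /det0P[v v0 vM]; exists v^T.
  by apply: contra v0 => /eqP vT; rewrite -[v]trmxK vT trmx0.
move/(congr1 trmx): vM; rewrite trmx_mul trmxK trmx0 mulmxBl mul_scalar_mx.
by move/eqP; rewrite subr_eq0 => /eqP.
Qed.

Lemma hermitian_form_real (C : numClosedFieldType) (n : nat) (M : 'M[C]_n)
    (v : 'rV[C]_n) :
  M \is hermsymmx -> (v *m M *m v ^t*) ord0 ord0 \is Num.real.
Proof.
rewrite hermsymmxE => /eqP hM; apply/CrealP.
have E : (v *m M *m v ^t*) ^t* = v *m M *m v ^t*.
  by rewrite !trmxCM hM trmxCK mulmxA.
by rewrite -[in RHS]E [RHS]mxE [in RHS]mxE.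
Qed.

Lemma hermitian_eigenvalue_real (C : numClosedFieldType) (n : nat)
    (M : 'M[C]_n) (l : C) :
  M \is hermsymmx -> eigenvalue M l -> l \is Num.real.
Proof.
move=> hM /eigenvalueP[v vM v0].
have := hermitian_form_real v hM; rewrite vM -scalemxAl mxE.
have p0 := norm_sq_gt0 v0.
by rewrite realrM ?(gt_eqF p0) // (gtr0_real p0).
Qed.

Lemma negative_definite_stable (R : realType) (n : nat) (M : 'M[R[i]]_n) :
  loewner_lt M 0 -> stable_mx M.
Proof.
move=> [_ _ Mneg] l /eigenvalueP[v vM v0].
have p0 := norm_sq_gt0 v0.
have /Mneg : v ^t* != 0.
  by apply: contra v0 => /eqP vT; rewrite -[v]trmxCK vT trmx0 map_mx0.
rewrite trmxCK vM mulmx0 mul0mx -scalemxAl.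
rewrite [X in X < _]mxE [X in _ < X]mxE pmulr_llt0 //.
by rewrite ltcE => /andP[].
Qed.

(** The rows of the unitary diagonalizing matrix are eigenvectors. *)
Lemma spectral_diag_eigenvalue (C : numClosedFieldType) (n : nat)
    (M : 'M[C]_n) (i : 'I_n) :
  M \is normalmx -> eigenvalue M (spectral_diag M ord0 i).
Proof.
move=> /orthomx_spectralP ME; apply/eigenvalueP.
have Pu := spectral_unit M.
exists (row i (spectralmx M)); last first.
  apply/negP => /eqP ri.
  have : row i (spectralmx M *m invmx (spectralmx M)) = 0.
    by rewrite row_mul ri mul0mx.
  rewrite mulmxV // => /rowP/(_ i); rewrite !mxE eqxx => /eqP.
  by rewrite oner_eq0.
rewrite [X in _ *m X]ME -row_mul !mulmxA mulmxV // mul1mx row_mul.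
by rewrite row_diag_mx -scalemxAl -rowE.
Qed.

(** In the coordinates [y = P x] of a unitary diagonalization the form is the
    sum of the [d_k |y_k|^2], where the [d_k] are real eigenvalues. *)
Lemma hermitian_stable_negative_definite (R : realType) (n : nat)
    (M : 'M[R[i]]_n) : M \is hermsymmx -> stable_mx M -> loewner_lt M 0.
Proof.
move=> hM sM; split; [exact: hM | by rewrite hermsymmxE trmx0 map_mx0 |].
move=> x x0; rewrite mulmx0 mul0mx.
have nM := hermitian_normalmx hM.
set P := spectralmx M; set d := spectral_diag M.
have dneg i : d ord0 i < 0.
  have /sM := spectral_diag_eigenvalue i nM.
  have /mxOverP/(_ ord0 i) := hermitian_spectral_diag_real hM.
  by rewrite -/d => /complex_realP[k ->] /= k0; rewrite ltcE /= eqxx k0.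
have -> : x ^t* *m M *m x = (P *m x) ^t* *m diag_mx d *m (P *m x).
  rewrite trmxCM (orthomx_spectralP nM) invmx_unitary ?spectral_unitarymx //.
  by rewrite !mulmxA.
have : P *m x != 0.
  apply: contra x0 => /eqP Px; apply/eqP.
  by rewrite -[x](mulKmx (spectral_unit M)) -/P Px mulmx0.
move: (P *m x) => y y0.
rewrite mul_mx_diag mxE [X in _ < X]mxE.
have [i yi] : exists i, y i ord0 != 0.
  apply: contrapT => /forallNP h; move/eqP: y0; apply; apply/colP => i.
  by rewrite mxE; apply/eqP; apply: contrapT => /negP /h.
have term k : ((\matrix_(i0, j) (y ^t* i0 j * d ord0 j)) ord0 k * y k ord0)
    = d ord0 k * `|y k ord0| ^+ 2.
  by rewrite !mxE normCK; ring.
rewrite (bigD1 i) //= ltr_wnDr //.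
  apply: sumr_le0 => k _; rewrite term.
  by apply: mulr_le0_ge0; [exact: ltW | exact: exprn_ge0].
by rewrite term pmulr_llt0 // exprn_gt0 // normr_gt0.
Qed.

(** The cross terms of [x = u + i v] cancel because [S] is symmetric; so the
    sign of a real form on complex vectors is decided on real ones. *)
Lemma complex_form_split (R : realType) (n : nat) (S : 'M[R]_n)
    (x : 'cV[R[i]]_n) (u := map_mx (@complex.Re R) x)
    (v := map_mx (@complex.Im R) x) : S^T = S ->
  (x ^t* *m complexmx S *m x) ord0 ord0 =
  ((u^T *m S *m u) ord0 ord0 + (v^T *m S *m v) ord0 ord0)%:C.
Proof.
move=> hS.
have xE : x = complexmx u + 'i *: complexmx v.
  by apply/matrixP => i j; rewrite !mxE [LHS]complexE.
have xtE : x ^t* = complexmx u^T - 'i *: complexmx v^T.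
  apply/matrixP => i j; rewrite !mxE.
  case: (x j i) => a b /=; apply/eqP; rewrite eq_complex /=.
  by apply/andP; split; apply/eqP; ring.
have cross : v^T *m S *m u = u^T *m S *m v.
  have sc (X : 'M[R]_1) : X^T = X by apply/matrixP => i j; rewrite mxE !ord1.
  by rewrite -[LHS]sc !trmx_mul trmxK hS mulmxA.
rewrite {1}xtE {1}xE !(mulmxDl, mulmxDr, mulNmx, =^~ scalemxAl, =^~ scalemxAr).
rewrite -!complexmxM cross scalerA -expr2 sqr_i.
move: (u^T *m S *m u) (u^T *m S *m v) (v^T *m S *m v) => a b d.
rewrite scaleN1r opprK addrA subrK mxE.
by rewrite [X in X + _]mxE [X in _ + X]mxE rmorphD.
Qed.

Lemma complexmx_form_ge0 (R : realType) (n : nat) (S : 'M[R]_n)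
    (x : 'cV[R[i]]_n) : S^T = S ->
  (forall y : 'cV[R]_n, 0 <= (y^T *m S *m y) ord0 ord0) ->
  0 <= (x ^t* *m complexmx S *m x) ord0 ord0.
Proof.
move=> hS h; rewrite complex_form_split; last exact: hS.
by rewrite ler0c addr_ge0.
Qed.

Lemma complexmx_negative_definite (R : realType) (n : nat) (S : 'M[R]_n) :
  S^T = S ->
  (forall y : 'cV[R]_n, y != 0 -> (y^T *m S *m y) ord0 ord0 < 0) ->
  loewner_lt (complexmx S) 0.
Proof.
move=> hS h; split.
- by rewrite hermsymmxE complexmx_conj hS.
- by rewrite hermsymmxE trmx0 map_mx0.
move=> x x0; rewrite mulmx0 mul0mx [X in _ < X]mxE.
rewrite complex_form_split; last exact: hS.
set u := map_mx _ x; set v := map_mx _ x.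
have le0 (y : 'cV[R]_n) : (y^T *m S *m y) ord0 ord0 <= 0.
  have [->|y0] := eqVneq y 0; last exact: ltW (h y y0).
  by rewrite mulmx0 mxE.
rewrite ltcE /= eqxx /=.
have [u0|u0] := eqVneq u 0; last exact: ltr_wnDr (le0 v) (h u u0).
have [v0|v0] := eqVneq v 0; last exact: ltr_wnDl (le0 u) (h v v0).
case/eqP: x0; apply/matrixP => i j; rewrite mxE.
move/matrixP/(_ i j): u0; move/matrixP/(_ i j): v0; rewrite !mxE => im re.
by apply/eqP; rewrite eq_complex re im /= eqxx.
Qed.

(** * The matrices Lambda and Theta on the imaginary axis *)

(** For imaginary [c] the adjoint of [A - c] is [A^T + c]. *)
Lemma Lambda_imaginary (R : realType) (n : nat) (Q A : 'M[R]_n) (c : R[i]) :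
  (c^*)%C = - c ->
  Lambda Q A c =
    complexmx (Q - A^T *m A) + c *: complexmx (A^T - A) + (c ^+ 2)%:M.
Proof.
move=> hc; rewrite /Lambda.
have -> : (complexmx A - c%:M) ^t* = complexmx A^T + c%:M.
  rewrite -complexmx_conj; apply/matrixP => i j; rewrite !mxE rmorphB /=.
  by rewrite rmorphMn eq_sym /= [X in _ - X *+ _]hc mulNrn opprK.
rewrite mulmxDl !mulmxBr -complexmxM mul_mx_scalar mul_scalar_mx.
rewrite -scalar_mxM -expr2 !complexmxB scalerBr.
apply/matrixP => i j; rewrite !mxE; ring.
Qed.

Lemma Lambda_hermitian (R : realType) (n : nat) (Q A : 'M[R]_n) (c : R[i]) :
  Q^T = Q -> Lambda Q A c \is hermsymmx.
Proof.
move=> hQ; rewrite hermsymmxE /Lambda raddfB /= map_mxB complexmx_conj hQ.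
by rewrite trmxCM trmxCK.
Qed.

(** The first block of the eigenvector is forced by the second block column of
    [Theta Q A]; the first block column then reads [b *m Lambda Q A c = 0]. *)
Lemma Theta_eigenvalue (R : realType) (n : nat) (Q A : 'M[R]_n) (c : R[i])
    (b : 'rV[R[i]]_n) :
  (c^*)%C = - c -> b != 0 -> b *m Lambda Q A c = 0 ->
  eigenvalue (complexmx (Theta Q A)) c.
Proof.
move=> hc b0; rewrite Lambda_imaginary // => bL; apply/eigenvalueP.
exists (row_mx (c *: b - b *m complexmx (A - A^T)) b); last first.
  by apply: contra b0; rewrite row_mx_eq0 => /andP[].
rewrite /complexmx /Theta map_block_mx -!/(complexmx _).
rewrite mul_row_block scale_row_mx.
rewrite /complexmx map_mx0 map_mx1 -!/(complexmx _) !mulmx0 mulmx1 add0r.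
congr row_mx; last by rewrite subrK.
move/eqP: bL; rewrite !mulmxDr mul_mx_scalar -scalemxAr.
rewrite !complexmxB !mulmxBr !scalerBr scalerA -expr2 => /eqP bL.
rewrite -[LHS]addr0 -bL; apply/matrixP => i j; rewrite !mxE; ring.
Qed.

Lemma conjc_imaginary (R : realType) (c : R[i]) :
  complex.Re c = 0 -> (c^*)%C = - c.
Proof.
by case: c => a b /= ->; apply/eqP; rewrite eq_complex /= oppr0 !eqxx.
Qed.

(** Continuation along [t |-> Lambda Q A (t c)]: a Hermitian matrix has an
    eigenvalue on the imaginary axis only if it is singular, and the hypothesis
    on [Theta Q A] excludes that. *)
Lemma Lambda_negative_on_imaginary_axis (R : realType) (n : nat)
    (Q A : 'M[R]_n) (c : R[i]) :
  Q^T = Q -> no_imaginary_eigenvalue (Theta Q A) ->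
  loewner_lt (Lambda Q A 0) 0 -> complex.Re c = 0 ->
  loewner_lt (Lambda Q A c) 0.
Proof.
move=> hQ hTheta L0 Rec.
pose M (t : R) := Lambda Q A (t%:C * c).
have tc (t : R) : complex.Re (t%:C * c) = 0.
  by case: c Rec {M} => a b /= ->; rewrite mulr0 mul0r subr0.
have ME t : M t = complexmx (Q - A^T *m A) + (t%:C * c) *: complexmx (A^T - A)
    + ((t%:C * c) ^+ 2)%:M.
  exact/Lambda_imaginary/conjc_imaginary.
have hermM t : M t \is hermsymmx by exact: Lambda_hermitian.
have -> : Lambda Q A c = M 1 by rewrite /M mul1r.
apply: hermitian_stable_negative_definite; first exact: hermM.
apply: stable_along_path.
- move=> i j; set X := complexmx (Q - A^T *m A) in ME.
  set Y := complexmx (A^T - A) in ME.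
  pose f (s : R) (_ : R[i]) :=
    X i j + s%:C * c * Y i j + s%:C * c * (s%:C * c) * (i == j)%:R.
  apply: (@time_lipschitz_ext R _ f).
    move=> s l; rewrite ME /f [RHS]mxE.
    rewrite [X in _ = X + _]mxE [X in _ = _ + X + _]mxE.
    by rewrite [X in _ = _ + X]mxE mulr_natr -expr2.
  have lip_tc : time_lipschitz (fun=> True) (fun (s : R) _ => s%:C * c).
    by apply: time_lipschitzM;
      [exact: time_lipschitz_time | exact: time_lipschitz_const].
  apply: time_lipschitzD; first apply: time_lipschitzD.
  + exact: time_lipschitz_const.
  + exact: (time_lipschitzM lip_tc (time_lipschitz_const _ (Y i j))).
  exact: (time_lipschitzM (time_lipschitzM lip_tc lip_tc)
            (time_lipschitz_const _ _)).
- move=> t _ l el; apply/negP => /eqP Rel.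
  have l0 : l = 0.
    have /complex_realP[k lk] := hermitian_eigenvalue_real (hermM t) el.
    by move: Rel; rewrite lk /= => ->.
  move/eigenvalueP: el => [b]; rewrite l0 scale0r => bM b0.
  have := hTheta _ (Theta_eigenvalue (conjc_imaginary (tc t)) b0 bM).
  by rewrite tc eqxx.
- have -> : M 0 = Lambda Q A 0 by rewrite /M mul0r.
  exact: negative_definite_stable.
Qed.

(** * Perturbations within the bound *)

Lemma trmxC_scale_real (R : realType) (m n : nat) (t : R)
    (A : 'M[R[i]]_(m, n)) : (t%:C *: A) ^t* = t%:C *: A ^t*.
Proof.
apply/matrixP => i j; rewrite !mxE rmorphM; congr (_ * _).
exact: conjc_real.
Qed.

Lemma Pi_form (R : realType) (n : nat) (Q A Z : 'M[R]_n) :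
  (col_mx 1%:M Z)^T *m Pi Q A *m col_mx 1%:M Z = Q - (A - Z)^T *m (A - Z).
Proof.
rewrite tr_col_mx trmx1 /Pi mul_row_block mul_row_col !mul1mx mulmx1.
rewrite mulmxN mulmx1 [(A - Z)^T]linearB /= !(mulmxBl, mulmxBr, mulmxDl) mulNmx.
apply/matrixP => i j.
move: (A^T *m A) (A^T *m Z) (Z^T *m A) (Z^T *m Z) => a b c d.
rewrite !mxE; ring.
Qed.

(** Continuation along the segment from [A] to [Z]. *)
Lemma perturbation_hurwitz (R : realType) (n : nat) (Q A Z : 'M[R]_n) :
  Q^T = Q -> hurwitz A ->
  (forall c : R[i], complex.Re c = 0 -> loewner_lt (Lambda Q A c) 0) ->
  (forall y : 'cV[R]_n,
     0 <= (y^T *m (Q - (A - Z)^T *m (A - Z)) *m y) ord0 ord0) ->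
  hurwitz Z.
Proof.
move=> hQ hA hL hZ.
set D := A - Z in hZ.
pose N (t : R) := complexmx A - t%:C *: complexmx D.
have N1 : N 1 = complexmx Z by rewrite /N scale1r -complexmxB /D subKr.
have N0 : N 0 = complexmx A by rewrite /N scale0r subr0.
rewrite /hurwitz -N1; apply: (@stable_along_path R n N).
- move=> i j.
  apply: (@time_lipschitz_ext R _
    (fun s _ => complexmx A i j + - (s%:C * complexmx D i j))).
    by move=> s l; rewrite /N [RHS]mxE [X in _ = _ + X]mxE [X in _ = _ - X]mxE.
  apply: time_lipschitzD; first exact: time_lipschitz_const.
  apply: time_lipschitzN; apply: time_lipschitzM.
    exact: time_lipschitz_time.
  exact: time_lipschitz_const.
- move=> t /andP[t0 t1] l /column_eigenvector[x x0 Nx]; apply/negP => /eqP Rel.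
  have [_ _ /(_ x x0)] := hL l Rel; rewrite mulmx0 mul0mx [X in _ < X]mxE.
  have Ax : (complexmx A - l%:M) *m x = t%:C *: (complexmx D *m x).
    by rewrite mulmxBl mul_scalar_mx -Nx /N mulmxBl subKr -scalemxAl.
  have SD : (Q - D^T *m D)^T = Q - D^T *m D.
    by rewrite linearB /= trmx_mul trmxK hQ.
  have := complexmx_form_ge0 x SD hZ.
  have := norm_sq_ge0 (complexmx D *m x).
  (* The form of [Lambda Q A l] at [x] is a sum of two nonnegative terms. *)
  have -> : x ^t* *m Lambda Q A l *m x = x ^t* *m complexmx (Q - D^T *m D) *m x
     + ((1 - t ^+ 2)%:C) *: ((complexmx D *m x) ^t* *m (complexmx D *m x)).
    have E (X : 'M[R[i]]_n) : x ^t* *m (complexmx Q - X ^t* *m X) *m x =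
        x ^t* *m complexmx Q *m x - (X *m x) ^t* *m (X *m x).
      by rewrite mulmxBr mulmxBl trmxCM !mulmxA.
    rewrite /Lambda E complexmxB complexmxM -complexmx_conj E Ax.
    rewrite trmxC_scale_real -scalemxAl -scalemxAr scalerA.
    rewrite rmorphB rmorphXn rmorph1 /= scalerBl scale1r expr2.
    by rewrite addrA subrK.
  set w := _ *m (complexmx D *m x); set q := _ *m x => w0 q0.
  apply/negP; rewrite le_gtF // mxE [X in _ + X]mxE.
  apply: (addr_ge0 q0); apply: mulr_ge0 w0.
  by rewrite ler0c subr_ge0 expr_le1.
- by rewrite N0.
Qed.

(** Evaluate the form at the multiple [q y - b x] of the component of [y]
    orthogonal to [x]; this choice needs no division. *)
Lemma form_cauchy_schwarz (R : realType) (n : nat) (Q : 'M[R]_n)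
    (x y : 'cV[R]_n) : Q^T = Q ->
  (forall y : 'cV[R]_n, 0 <= (y^T *m Q *m y) ord0 ord0) ->
  0 < (x^T *m Q *m x) ord0 ord0 ->
  (x^T *m Q *m y) ord0 ord0 ^+ 2 <=
    (x^T *m Q *m x) ord0 ord0 * (y^T *m Q *m y) ord0 ord0.
Proof.
move=> hQ Q0; set q := (X in 0 < X); set b := (x^T *m Q *m y) _ _ => q0.
set r := (y^T *m Q *m y) _ _.
have byx : (y^T *m Q *m x) ord0 ord0 = b.
  have sc (X : 'M[R]_1) : X^T = X by apply/matrixP => i j; rewrite mxE !ord1.
  by rewrite -[y^T *m Q *m x]sc !trmx_mul trmxK hQ mulmxA.
have := Q0 (q *: y - b *: x).
have -> : ((q *: y - b *: x)^T *m Q *m (q *: y - b *: x)) ord0 ord0 =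
   q * (q * r - b ^+ 2).
  have zT : (q *: y - b *: x)^T = q *: y^T - b *: x^T.
    by apply/matrixP => i j; rewrite !mxE.
  rewrite zT !(mulmxBl, mulmxBr) -!(scalemxAl, scalemxAr).
  move: byx; rewrite /q /b /r.
  move: (x^T *m Q *m x) (x^T *m Q *m y) (y^T *m Q *m x)
    (y^T *m Q *m y) => a d e f.
  by rewrite !mxE => ->; ring.
by rewrite pmulr_rge0 // subr_ge0.
Qed.

Lemma form_residual (R : realType) (n : nat) (Q D : 'M[R]_n) (y : 'cV[R]_n) :
  (y^T *m (Q - D^T *m D) *m y) ord0 ord0 =
  (y^T *m Q *m y) ord0 ord0 - ((D *m y)^T *m (D *m y)) ord0 ord0.
Proof.
rewrite mulmxBr mulmxBl trmx_mul !mulmxA [LHS]mxE; congr (_ + _).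
by rewrite [LHS]mxE.
Qed.

(** The rank-one [D] sending [y] to [(x^T Q y / x^T Q x) A x] agrees with [A] at
    [x].  The hypothesis [|A x|^2 <= x^T Q x] and Cauchy-Schwarz for [Q] bound
    [|D y|^2] by [y^T Q y]. *)
Lemma singular_perturbation (R : realType) (n : nat) (Q A : 'M[R]_n)
    (x : 'cV[R]_n) : Q^T = Q ->
  (forall y : 'cV[R]_n, y != 0 -> 0 < (y^T *m Q *m y) ord0 ord0) ->
  x != 0 -> 0 <= (x^T *m (Q - A^T *m A) *m x) ord0 ord0 ->
  exists2 Z : 'M[R]_n,
    loewner_le 0 (Q - (A - Z)^T *m (A - Z)) & Z *m x = 0.
Proof.
move=> hQ Qpos x0; rewrite form_residual => Ax.
have q0 := Qpos x x0; set q := (x^T *m Q *m x) ord0 ord0 in q0 Ax.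
pose D := q^-1 *: (A *m x *m (x^T *m Q)).
have Dy (y : 'cV[R]_n) :
    D *m y = ((x^T *m Q *m y) ord0 ord0 / q) *: (A *m x).
  rewrite /D -scalemxAl -(mulmxA (A *m x)).
  rewrite [X in _ *: (_ *m X) = _]mx11_scalar mul_mx_scalar.
  by rewrite scalerA mulrC.
have Q0 (y : 'cV[R]_n) : 0 <= (y^T *m Q *m y) ord0 ord0.
  have [->|y0] := eqVneq y 0; last exact: ltW (Qpos y y0).
  by rewrite mulmx0 mxE.
exists (A - D); last by rewrite mulmxBl Dy -/q divff ?gt_eqF // scale1r subrr.
rewrite subKr; split.
- by rewrite symmetricmxE trmx0.
- by rewrite symmetricmxE linearB /= trmx_mul trmxK hQ.
move=> y; rewrite mulmx0 mul0mx form_residual [X in X <= _]mxE Dy.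
rewrite [(_ *: (A *m x))^T]linearZ /= -scalemxAl -scalemxAr scalerA.
have := form_cauchy_schwarz y hQ Q0 q0; rewrite -/q.
set b := (x^T *m Q *m y) ord0 ord0; set r := (y^T *m Q *m y) ord0 ord0.
move: Ax; set p := (A *m x)^T *m _ => Ax cs.
rewrite subr_ge0 mxE; apply: (@le_trans _ _ (b / q * (b / q) * q)).
  by apply: ler_wpM2l; [rewrite -expr2 sqr_ge0 | rewrite -subr_ge0].
rewrite mulrA divfK ?gt_eqF // mulrAC -expr2 ler_pdivrMr // mulrC //.
Qed.

(** * The bound Qgamma and the equivalence *)

Lemma Qgamma_symmetric (R : realType) (n : nat) (gamma : R) (A : 'M[R]_n) :
  (Qgamma gamma A)^T = Qgamma gamma A.
Proof.
by rewrite /Qgamma linearZ linearD /= trmx1 trmx_mul trmxK.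
Qed.

Lemma Qgamma_positive_definite (R : realType) (n : nat) (gamma : R)
    (A : 'M[R]_n) (y : 'cV[R]_n) : 0 < gamma -> y != 0 ->
  0 < (y^T *m Qgamma gamma A *m y) ord0 ord0.
Proof.
move=> g0 y0.
have sq0 m (z : 'cV[R]_m) : 0 <= (z^T *m z) ord0 ord0.
  by rewrite mxE sumr_ge0 // => i _; rewrite mxE -expr2 sqr_ge0.
rewrite /Qgamma -scalemxAr -scalemxAl mxE mulr_gt0 ?exprn_gt0 //.
rewrite mulmxDr mulmx1 mulmxDl.
have -> : y^T *m (A^T *m A) *m y = (A *m y)^T *m (A *m y).
  by rewrite trmx_mul !mulmxA.
rewrite mxE.
rewrite ltr_wpDr // lt_neqAle sq0 andbT eq_sym; apply: contra y0 => /eqP s0.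
apply/eqP/colP => i; rewrite mxE.
move: s0; rewrite mxE => /psumr_eq0P s0.
have /eqP : y^T ord0 i * y i ord0 = 0.
  by apply: s0 => // j _; rewrite mxE -expr2 sqr_ge0.
by rewrite mxE mulf_eq0 orbb => /eqP.
Qed.

Unset Implicit Arguments.

Theorem theorem2 (R : realType) (n : nat) (Am : 'M[R]_n) (gamma : R)
  (hAm : hurwitz Am) (hgamma : 0 < gamma)
  (hTheta : no_imaginary_eigenvalue (Theta (Qgamma gamma Am) Am)) :
  (forall Z : 'M[R]_n, Zset (Pi (Qgamma gamma Am) Am) Z -> hurwitz Z)
  <-> loewner_lt (Lambda (Qgamma gamma Am) Am 0) 0.
Proof.
have hQ := Qgamma_symmetric gamma Am.
have Qpos := fun y => @Qgamma_positive_definite R n gamma Am y hgamma.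
move: hQ Qpos hTheta; set Q := Qgamma gamma Am => hQ Qpos hTheta.
split=> [hZ|L0 Z].
- have -> : Lambda Q Am 0 = complexmx (Q - Am^T *m Am).
    rewrite Lambda_imaginary ?conjc_imaginary // scale0r addr0 expr0n /=.
    by rewrite raddf0 addr0.
  apply: complexmx_negative_definite => [|x x0].
    by rewrite linearB /= trmx_mul trmxK hQ.
  rewrite ltNge; apply/negP => Lx.
  have [Z Zin Zx] := singular_perturbation hQ Qpos x0 Lx.
  have /hZ/(_ 0) : Zset (Pi Q Am) Z by rewrite /Zset /= Pi_form.
  rewrite eigenvalue_root_char => singular.
  have : root (char_poly (complexmx Z)) 0.
    apply/rootP; rewrite horner_char_poly; apply/eqP; rewrite -det_tr.
    apply/det0P; exists (complexmx x)^T.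
      apply: contra x0 => /eqP/matrixP xe; apply/eqP/matrixP => i j.
      by move/(_ j i): xe; rewrite !mxE => -[].
    by rewrite -trmx_mul raddf0 sub0r mulNmx -complexmxM Zx /complexmx
      map_mx0 oppr0 trmx0.
  by move/singular; rewrite ltxx.
- rewrite /Zset /= Pi_form => -[_ _ hZ].
  apply: (perturbation_hurwitz hQ hAm) => [c Rec|y].
    exact: Lambda_negative_on_imaginary_axis.
  by have := hZ y; rewrite mulmx0 mul0mx mxE.
Qed.
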